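(* Let $n$ be a positive integer, $G=\mathbb{Z}\times\mathbb{Z}_n=\langle z\rangle\times\langle a\rangle$, and let $\mathcal{S}$ be a Schur ring over $G$. Let $H$ be the maximal $\mathcal{S}$-subgroup of $G$ contained in $\mathbb{Z}$. Suppose $n\mid[\mathbb{Z}:H]$, and let $K$ be the unique subgroup of $\mathbb{Z}$ with $[K:H]=n$ (if $[\mathbb{Z}:H]=\infty$, i.e. $H=1$, set $K=1$). Then every $\mathcal{S}$-class contained in $G\setminus(K\times\mathbb{Z}_n)$ is a union of cosets of some nontrivial $\mathcal{S}$-subgroup of $\mathbb{Z}_n$.
   Context: $F$ is a field of characteristic $0$; $\mathbb{Z}=\langle z\rangle$ is infinite cyclic and $\mathbb{Z}_n=\langle a\rangle$ is cyclic of order $n$, written multiplicatively. For finite $C\subseteq G$, $\overline{C}=\sum_{g\in C}g\in F[G]$ and $C^*=\{g^{-1}:g\in C\}$. A Schur ring over $G$ is a subspace $\mathcal{S}=\mathrm{Span}_F\{\overline{C}:C\in\mathcal{D}\}$ of $F[G]$, where $\mathcal{D}=\mathcal{D}(\mathcal{S})$ is a partition of $G$ into finite subsets with $\{1\}\in\mathcal{D}$, $C\in\mathcal{D}\Rightarrow C^*\in\mathcal{D}$, and each product $\overline{C}\,\overline{D}$ ($C,D\in\mathcal{D}$) a finite $F$-linear combination of the $\overline{E}$, $E\in\mathcal{D}$. Members of $\mathcal{D}(\mathcal{S})$ are $\mathcal{S}$-classes; an $\mathcal{S}$-subset is a union of $\mathcal{S}$-classes; an $\mathcal{S}$-subgroup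 is a subgroup which is an $\mathcal{S}$-subset (the $\mathcal{S}$-subgroups contained in $\mathbb{Z}$ have a unique maximal element). *)

(* Defs.v *)
From HB Require Import structures.
From mathcomp Require Import all_boot all_order all_algebra.
From mathcomp Require Import finmap.
Set Implicit Arguments. Unset Strict Implicit. Unset Printing Implicit Defensive.
Import Order.TTheory GRing.Theory Num.Theory.
Local Open Scope fset_scope.

(* The group G = Z x Z_n, elements (k, a) with k : int and a : 'I_n
   (the residue a mod n); written multiplicatively in the paper as z^k a^a. *)
Definition Gt (n : nat) := (int * 'I_n)%type.

Lemma ord_pos (n : nat) (a : 'I_n) : 0 < n.
Proof. exact: leq_ltn_trans (leq0n a) (ltn_ord a). Qed.

Definition addI (n : nat) (a b : 'I_n) : 'I_n :=
  Ordinal (ltn_pmod (a + b) (ord_pos a)).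
Definition oppI (n : nat) (a : 'I_n) : 'I_n :=
  Ordinal (ltn_pmod (n - a) (ord_pos a)).

Definition gmul (n : nat) (g h : Gt n) : Gt n := ((g.1 + h.1)%R, addI g.2 h.2).
Definition ginv (n : nat) (g : Gt n) : Gt n := ((- g.1)%R, oppI g.2).
Definition is_one (n : nat) (g : Gt n) : bool := (g.1 == 0%R) && (val g.2 == 0).

(* coefficient of g in the product  \bar C * \bar D  in F[G] *)
Definition prod_coef (F : fieldType) (n : nat) (C D : {fset Gt n}) (g : Gt n) : F :=
  (\sum_(c <- enum_fset C) \sum_(d <- enum_fset D) ((gmul c d == g)%:R : F))%R.

(* coefficient of g in the F-linear combination  \sum_(p in s) p.1 * \bar{p.2} *)
Definition lin_coef (F : fieldType) (n : nat) (s : seq (F * {fset Gt n})) (g : Gt n) : F :=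
  (\sum_(p <- s | g \in p.2) p.1)%R.

Definition is_schur_partition (F : fieldType) (n : nat) (D : {fset Gt n} -> Prop) : Prop :=
  (forall C, D C -> C != fset0) /\
  [/\
      (forall g, exists C, D C /\ g \in C),
      (forall C C' g, D C -> D C' -> g \in C -> g \in C' -> C = C'),
      (exists C, D C /\ forall g, (g \in C) = is_one g),
      (forall C, D C -> D [fset ginv x | x in C]) &
      (forall C C', D C -> D C' ->
         exists s : seq (F * {fset Gt n}),
           (forall p, p \in s -> D p.2) /\
           (forall g, prod_coef F C C' g = lin_coef s g))].

Definition is_subgroup (n : nat) (X : Gt n -> Prop) : Prop :=
  [/\ (forall g, is_one g -> X g),
      (forall g h, X g -> X h -> X (gmul g h)) &
      (forall g, X g -> X (ginv g))].

Definition is_S_subset (n : nat) (D : {fset Gt n} -> Prop) (X : Gt n -> Prop) : Prop :=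
  forall C, D C -> (forall g, g \in C -> X g) \/ (forall g, g \in C -> ~ X g).

Definition is_S_subgroup (n : nat) (D : {fset Gt n} -> Prop) (X : Gt n -> Prop) : Prop :=
  is_subgroup X /\ is_S_subset D X.

Definition inZ (n : nat) (g : Gt n) : Prop := val g.2 = 0.
Definition inZn (n : nat) (g : Gt n) : Prop := g.1 = 0%R.

(* the subgroup m Z = <z^m> of Z (m = 0 gives the trivial subgroup) *)
Definition multZ (n m : nat) (g : Gt n) : Prop := val g.2 = 0 /\ (m%:Z %| g.1)%Z.
Definition multZ_times_Zn (n k : nat) (g : Gt n) : Prop := (k%:Z %| g.1)%Z.

(* Main.v *)
Require Import Defs.
From HB Require Import structures.
From mathcomp Require Import all_boot all_order all_fingroup all_algebra.
From mathcomp Require Import cyclic pgroup sylow finmap zify ring.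
Import Order.TTheory GRing.Theory Num.Theory.
Set Implicit Arguments. Unset Strict Implicit. Unset Printing Implicit Defensive.
Local Open Scope ring_scope.

(* Write C^(m) for {x^m : x in C}. If m = 1 mod n, then x |-> x^m fixes Z_n
   pointwise, is injective, and maps S-sets to S-sets (Wielandt). Hence Z_n is
   an S-subgroup, so S induces a Schur ring over Z, whose classes lie in sets
   {z^k, z^-k}; a class C therefore lies in {z^k, z^-k} Z_n. If k <> 0, the part
   of C^(n+1) C^* over z^(+-nk), added to its inverse, has at z^(+-nk) b the
   coefficient #{x in C : x b^-1 in C}, which is |C| exactly when b stabilises
   C. If the stabiliser of C, always an S-subgroup of Z_n, is trivial, then
   {z^(nk), z^(-nk)} is an S-set; it generates an S-subgroup, so z^(nk) lies in
   H and z^k in K. *)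

(** * Multisets and iterated products *)

Section Multisets.
Variable Gam : zmodType.
Implicit Types (s t u : seq Gam) (g h : Gam).

Definition conv s t : seq Gam := [seq x + y | x <- s, y <- t].

Lemma count_conv s t g :
  count_mem g (conv s t) = (\sum_(x <- s) count_mem (g - x)%R t)%N.
Proof.
elim: s => [|x s IHs]; first by rewrite big_nil.
rewrite big_cons -IHs /conv allpairs_cons count_cat count_map.
congr (_ + _)%N; apply: eq_count => y /=.
by rewrite [RHS]eq_sym subr_eq eq_sym addrC.
Qed.

Lemma count_opp s g :
  count_mem g (map -%R s) = count_mem (- g) s.
Proof. by rewrite count_map; apply: eq_count => x /=; rewrite eqr_oppLR. Qed.

Lemma conv_opp s t :
  map -%R (conv s t) = conv (map -%R s) (map -%R t).
Proof.
elim: s => // x s IHs; rewrite /conv /= map_cat -/(conv s t) IHs; congr (_ ++ _).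
by rewrite -!map_comp; apply: eq_map => y /=; rewrite opprD.
Qed.

Lemma count_map_ord (f : Gam -> Gam) s g :
  count_mem g (map f s) = #|[set i : 'I_(size s) | f s`_i == g]|.
Proof.
rewrite count_map -sum1_count (big_nth 0) big_mkord -sum1_card.
by apply: eq_bigl => i; rewrite inE.
Qed.

Lemma card_tupleS (T : finType) (v : T -> Gam) j g :
  #|[set t : j.+1.-tuple T | \sum_(i <- t) v i == g]| =
  (\sum_(x : T) #|[set t : j.-tuple T | (\sum_(i <- t) v i == g - v x)%R]|)%N.
Proof.
rewrite -sum1_card; under [RHS]eq_bigr do rewrite -sum1_card.
rewrite pair_big_dep /=.
rewrite (reindex (fun q : T * j.-tuple T => cons_tuple q.1 q.2)) /=.
  by apply: eq_bigl => -[x w]; rewrite !inE /= big_cons [RHS]eq_sym subr_eq eq_sym addrC.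
exists (fun w => (thead w, behead_tuple w)) => [[x w]|w] _.
  by rewrite /= theadE; congr (_, _); apply: val_inj.
by rewrite [RHS]tuple_eta; apply: val_inj.
Qed.

(** Tuples of indices, not of values, so that a repeated term of [s] counts with its multiplicity
    and rotation acts on a finite type. *)
Lemma count_conv_iter s j g :
  count_mem g (iter j (conv s) [:: 0]) =
  #|[set t : j.-tuple 'I_(size s) | \sum_(i <- t) s`_i == g]|.
Proof.
elim: j g => [|j IHj] g.
  rewrite /= addn0; have [->|ng] := eqVneq 0 g; apply/esym.
    by rewrite (eq_card1 (x := [tuple])) // => t; rewrite !inE !tuple0 big_nil !eqxx.
  by apply: eq_card0 => t; rewrite !inE tuple0 big_nil; apply: negbTE.
rewrite card_tupleS iterS count_conv (big_nth 0) big_mkord.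
by apply: eq_bigr => i _; apply: IHj.
Qed.

End Multisets.

(** With [x = y] this is invariance under rotation by one place: each entry equals the next. The
    induction has to carry [x = y] along. *)
Lemma rcons_cons_nseq (T : Type) (x y : T) s :
  rcons s x = y :: s -> s = nseq (size s) x.
Proof.
suff H : rcons s x = y :: s -> s = nseq (size s) x /\ x = y by move=> /H[].
elim: s y => [|z s IHs] y /= []; first by [].
by move=> <- /IHs[{1}-> <-].
Qed.

(** * Rotation of tuples and p-th powers modulo p *)

Section Rotation.
Variables (T : finType) (p : nat).

Definition rotate (t : p.-tuple T) : p.-tuple T := [tuple of rot 1 t].

Lemma rotate_inj : injective rotate.
Proof. by move=> t u /(congr1 val) /rot_inj /val_inj. Qed.

Lemma perm_rotate t : perm_eq (rotate t) t.
Proof. by rewrite -[tval (rotate t)]/(rot 1 t) perm_rot. Qed.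

Lemma rotate_permX j (t : p.-tuple T) : (j <= p)%N ->
  val ((perm rotate_inj ^+ j)%g t) = rot j t.
Proof.
elim: j => [|j IHj] jp; first by rewrite expg0 perm1 rot0.
by rewrite expgSr permM permE /= IHj ?(ltnW jp)// -rotS ?size_tuple// .
Qed.

Lemma rotate_fix (t : p.-tuple T) : prime p ->
  (rotate t == t) = [exists x, t == [tuple of nseq p x]].
Proof.
move=> pp; apply/eqP/existsP => [|[x /eqP ->]]; last first.
  apply: val_inj => /=; case: (p) => [|q] //=.
  by rewrite /rot /= drop0 take0 cats1; elim: q => //= q ->.
case: t => -[|x s] sz /(congr1 val) /=; rewrite /rot /=.
  by exfalso; move: pp; rewrite -(eqP sz).
rewrite drop0 take0 cats1 => E.
have sE := rcons_cons_nseq E; exists x.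
by apply/eqP/val_inj; rewrite /= {1}sE -(eqP sz).
Qed.

End Rotation.

Section Frobenius.
Variable Gam : zmodType.
Implicit Types (s : seq Gam) (g : Gam).

(* The p-tuples of terms of s with sum g are permuted by rotation, and the
   fixed ones are the constant tuples. *)
Lemma count_conv_iter_prime s (p : nat) g : prime p ->
  count_mem g (iter p (conv s) [:: 0]) =
    count_mem g [seq x *+ p | x <- s] %[mod p].
Proof.
move=> pp; rewrite count_conv_iter count_map_ord.
set S := [set t | _].
pose r := perm (@rotate_inj 'I_(size s) p).
(* Rotation by p places is the identity, so [r] generates a p-group, whose fixed points count [S]
   modulo p. *)
have rX : (r ^+ p)%g = 1%g.
  apply/permP => t; apply: val_inj.
  by rewrite rotate_permX // perm1 -{1}(size_tuple t) rot_size.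
have pr : (p.-group <[r]>)%g.
  by apply: (pnat_dvd (n := p)); rewrite ?pnat_id // -orderE order_dvdn rX.
have actS : [acts <[r]>%g, on S | 'P].
  rewrite cycle_subG inE; apply/andP; split; first by rewrite inE.
  rewrite inE; apply/subsetP => t; rewrite !inE /= apermE permE /=.
  by rewrite (perm_big _ (perm_rotate t)).
rewrite (pgroup_fix_mod pr actS) afix_cycle; congr (_ %% _)%N.
have injn : injective (fun i : 'I_(size s) => [tuple of nseq p i]).
  move=> i j /(congr1 val) /=; case: (p) pp => // q _ /= -[]//.
rewrite -(card_imset _ injn); apply: eq_card => t.
rewrite in_setI [t \in S]inE.
have E (i : 'I_(size s)) : \sum_(j <- nseq p i) s`_j = s`_i *+ p.
  by rewrite big_nseq iter_addr_0.
apply/andP/imsetP => [[/eqP St /afix1P]|[i Si ->]].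
  rewrite /= apermE permE => /eqP; rewrite rotate_fix // => /existsP[i /eqP ti].
  by exists i; rewrite // inE -E -St ti.
rewrite inE -E in Si; split=> //.
apply/afix1P; rewrite /= apermE permE; apply/eqP.
by rewrite rotate_fix //; apply/existsP; exists i.
Qed.
End Frobenius.

(** * Families closed under the Schur ring operations *)

(* A multiset over Gam, given as a sequence, stands for an element of the group
   ring with natural coefficients; the first field says that P is closed under
   every operation computed coefficientwise. *)
Record schur_family (Gam : zmodType) (P : seq Gam -> Prop) : Prop := SchurFamily {
  schur_measurable : forall s t u, P s -> P t ->
    (forall g h, count_mem g s = count_mem h s -> count_mem g t = count_mem h t ->
       count_mem g u = count_mem h u) -> P u;
  schur_conv : forall s t, P s -> P t -> P (conv s t);
  schur_opp : forall s, P s -> P (map -%R s)}.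

Section SchurFamily.
Variables (Gam : zmodType) (P : seq Gam -> Prop).
Hypothesis schurP : schur_family P.
Implicit Types (s t u : seq Gam) (g h : Gam).

Lemma schur_count s u : P s ->
  (forall g h, count_mem g s = count_mem h s -> count_mem g u = count_mem h u) -> P u.
Proof. by move=> Ps su; apply: (schur_measurable schurP Ps Ps) => g h /su. Qed.

(** Selects part of a set by the coefficients of another member [t]: the multiplicities in [s] and
    [t] together decide membership in the filtered set. *)
Lemma schur_filter (a : Gam -> bool) s : P s -> uniq s ->
  (exists2 t, P t & {in s &, forall g h, count_mem g t = count_mem h t -> a g = a h}) ->
  P (filter a s).
Proof.
move=> Ps Us [t Pt at_]; apply: (schur_measurable schurP Ps Pt) => g h.
rewrite !(count_uniq_mem _ Us) !(count_uniq_mem _ (filter_uniq _ Us)) !mem_filter.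
move=> /(can_inj oddb) sgh tgh.
case sg: (g \in s); last by rewrite -sgh sg !andbF.
by rewrite -sgh sg !andbT (at_ g h) // -sgh.
Qed.

(** Modulo a prime p, the p-th power of [s] in the group ring agrees with its image under x -> x^p.
    By injectivity that image has coefficients 0 and 1, so the residues determine it. A composite
    [m] is handled one prime factor at a time. *)
Lemma schur_power s (m : nat) : (0 < m)%N ->
  injective (fun x : Gam => x *+ m) -> P s -> uniq s -> P [seq x *+ m | x <- s].
Proof.
elim/ltn_ind: m s => m IHm s m0 injm Ps Us.
have [m1|m1] := leqP m 1.
  have -> : m = 1%N by lia.
  by rewrite (eq_map (@mulr1n _)) map_id.
have pp := pdiv_prime m1; have /dvdnP[q mE] := pdiv_dvd m.
set p := pdiv m in pp mE; have p1 := prime_gt1 pp.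
have injp : injective (fun x : Gam => x *+ p).
  by move=> x y /= xy; apply: injm; rewrite /= mE mulnC !mulrnA xy.
have injq : injective (fun x : Gam => x *+ q).
  by move=> x y /= xy; apply: injm; rewrite /= mE !mulrnA xy.
have Pp : P [seq x *+ p | x <- s].
  (* Only positive powers: the zeroth, [[:: 0]], is not assumed to be in [P]. *)
  have Piter j : P (iter j.+1 (conv s) [:: 0]).
    elim: j => [|j IHj]; last exact: (schur_conv schurP).
    by rewrite /= /conv allpairs1r; under eq_map do rewrite addr0; rewrite map_id.
  have := Piter p.-1; rewrite prednK ?prime_gt0 // => Pi.
  apply: (schur_count Pi) => g h /(congr1 (modn^~ p)) /=.
  rewrite !count_conv_iter_prime // !count_uniq_mem ?map_inj_uniq //.
  by rewrite !modn_small // (leq_ltn_trans (leq_b1 _)).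
have -> : [seq x *+ m | x <- s] = [seq x *+ q | x <- [seq x *+ p | x <- s]].
  by rewrite -map_comp; apply: eq_map => x /=; rewrite -mulrnA mulnC -mE.
by apply: IHm => //; [nia|nia|rewrite map_inj_uniq].
Qed.

End SchurFamily.

(** * Schur rings over the infinite cyclic group *)

Lemma int_mulrn (x : int) (m : nat) : x *+ m = x * m%:Z.
Proof. by rewrite -mulr_natr natz. Qed.

Lemma int_mulrn_inj (m : nat) : (0 < m)%N -> injective (fun x : int => x *+ m).
Proof.
move=> m0 x y /=; rewrite !int_mulrn => /mulIf; apply; lia.
Qed.

Section Integers.
Variable P : seq int -> Prop.
Hypothesis schurP : schur_family P.
Implicit Types (X : seq int) (k : int).

Lemma schur_int_power X (m : nat) : (0 < m)%N -> P X -> uniq X -> P [seq x *+ m | x <- X].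
Proof.
by move=> m0; apply: (schur_power schurP) => //; apply: int_mulrn_inj.
Qed.

Lemma int_seq_bound X : exists M : nat, {in X, forall x, `|x| <= M%:Z}.
Proof.
elim: X => [|x X [M XM]]; first by exists 0%N.
exists (maxn `|x| M)%N => y; rewrite inE => /predU1P[->|/XM]; lia.
Qed.

(* With [R] a large multiple of [N], the only sums [R x' - (R-1) y] lying in
   [X] are those with [x' = y]. *)
Lemma schur_int_root X (a : int -> bool) (N : nat) : (0 < N)%N ->
  P X -> uniq X -> P [seq x *+ N | x <- X & a x] -> P (filter a X).
Proof.
move=> N0 PX UX PN; have [M XM] := int_seq_bound X.
(* With R = N j > 2M, a sum w = R x - (R-1) y in [X] gives (x - y) R = w - y, of absolute value at
   most 2M, hence x = y. *)
pose j := (2 * M).+2.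
have UN : uniq [seq x *+ N | x <- X & a x].
  by rewrite map_inj_uniq ?filter_uniq //; apply: int_mulrn_inj.
have := schur_conv schurP (@schur_int_power _ j isT PN UN)
  (schur_opp schurP (@schur_int_power X (N * j).-1 ltac:(rewrite /j; nia) PX UX)).
set V := conv _ _ => PV.
apply: (schur_filter schurP PX UX); exists V => // g h gX hX gh.
have aE w : w \in X -> a w = (0 < count_mem w V)%N.
  move=> wX; rewrite -has_count has_pred1; apply/idP/allpairsP => [aw|].
    exists (w *+ N *+ j, - (w *+ (N * j).-1)); split=> /=.
    - by apply/map_f/map_f; rewrite mem_filter aw.
    - exact/map_f/map_f.
    - have -> : w *+ N *+ j = w *+ (N * j).-1.+1 by rewrite -mulrnA prednK // muln_gt0 N0.
      by rewrite mulrS addrK.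
  move=> [[_ _] /= [/mapP[_ /mapP[x xX ->] ->] /mapP[_ /mapP[y yX ->] ->] wE]].
  move: xX; rewrite mem_filter => /andP[ax xX].
  have := XM _ wX; have := XM _ xX; have := XM _ yX => My Mx Mw.
  suff -> : w = x by [].
  have E : (x - y) * (N * j)%:Z = w - y.
    have R1 : (N * j).-1%:Z = (N * j)%:Z - 1 by rewrite /j; nia.
    by rewrite wE -mulrnA !int_mulrn R1; ring.
  have R2 : (2 * M < N * j)%N by rewrite /j; nia.
  have : x = y by nia.
  lia.
by rewrite !aE // gh.
Qed.

Lemma int_seq_max X k : k \in X -> exists2 y, y \in X & {in X, forall x, `|x| <= `|y|}.
Proof.
elim: X k => // x [|x' X] IHX k _.
  by exists x => [|y]; rewrite inE // => /eqP->.
have [y yX yM] := IHX x' (mem_head _ _).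
have [xy|yx] := leP `|x| `|y|.
  by exists y; rewrite 1?inE ?yX ?orbT // => z; rewrite inE => /predU1P[->|/yM].
exists x; rewrite ?mem_head // => z; rewrite inE => /predU1P[->//|/yM zy].
exact: le_trans zy (ltW yx).
Qed.

(** For each x at most one y in [X] gives a x + b y = z, because b is positive; so it suffices to
    count the x. *)
Lemma count_conv_mulrn X (a b : nat) z : (0 < b)%N -> uniq X ->
  count_mem z (conv [seq x *+ a | x <- X] [seq x *+ b | x <- X]) =
  count (fun x => z - x *+ a \in [seq y *+ b | y <- X]) X.
Proof.
move=> b0 UX; rewrite count_conv big_map -sum1_count [RHS]big_mkcond.
apply: eq_bigr => x _; rewrite count_uniq_mem; first by case: ifP.
by rewrite map_inj_uniq //; apply: int_mulrn_inj.
Qed.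

(* If [M] is the largest and [x] a smaller element of [X], then in
   [(M + x) X + (M - x) X] the sum [2M x] also arises as [(M + x) M - (M - x) M],
   while [2M M] and [- 2M M] arise only once: this splits [X]. *)
Lemma schur_int_split X (M x : int) :
  P X -> uniq X -> {in X, forall y, - y \in X} ->
  M \in X -> x \in X -> {in X, forall y, `|y| <= M} -> `|x| < M ->
  exists a : int -> bool, [/\ P (filter a X), forall y, a (- y) = a y, a M & ~~ a x].
Proof.
move=> PX UX SX MX xX XM xM.
pose a := `|(M + x)%R|%N; pose b := `|(M - x)%R|%N; pose N := `|(2 * M)%R|%N.
have aE : a%:Z = M + x by rewrite /a; lia.
have bE : b%:Z = M - x by rewrite /b; lia.
have NE : N%:Z = 2 * M by rewrite /N; lia.
have a0 : (0 < a)%N by lia.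
have b0 : (0 < b)%N by lia.
have N0 : (0 < N)%N by lia.
have XS : perm_eq (map -%R X) X.
  apply: uniq_perm; rewrite ?map_inj_uniq //; first exact: oppr_inj.
  move=> y; apply/mapP/idP => [[z zX ->]|yX]; first exact: SX.
  by exists (- y); rewrite ?SX ?opprK.
pose T := conv [seq x *+ a | x <- X] [seq x *+ b | x <- X].
have PT : P T by apply: (schur_conv schurP); apply: schur_int_power.
(* The splitting predicate asks whether the multiple [N] y has multiplicity one in [T]. It is even
   because [X] is symmetric, and [schur_int_root] divides the selected multiples by [N]. *)
pose f z := count_mem z T == 1%N.
have fN z : f (- z) = f z.
  rewrite /f -count_opp; suff /seq.permP -> : perm_eq (map -%R T) T by [].
  have -> : map -%R T = conv [seq x *+ a | x <- map -%R X] [seq x *+ b | x <- map -%R X].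
    have oppM c : [seq y *+ c | y <- map -%R X] = map -%R [seq y *+ c | y <- X].
      by rewrite -!map_comp; apply: eq_map => y /=; rewrite mulNrn.
    by rewrite /T conv_opp !oppM.
  by apply: perm_allpairs; apply: perm_map.
exists (fun y => f (y *+ N)); split.
- apply: (schur_int_root N0) => //.
  have -> : [seq x *+ N | x <- X & f (x *+ N)] = filter f [seq x *+ N | x <- X].
    by rewrite filter_map.
  apply: (schur_filter schurP); first exact: schur_int_power.
    by rewrite map_inj_uniq //; apply: int_mulrn_inj.
  by exists T => // g h _ _ gh; rewrite /f gh.
- by move=> y; rewrite mulNrn fN.
- rewrite /f count_conv_mulrn //.
  set c := count _ _; suff -> : c = count_mem M X by rewrite count_uniq_mem ?MX.
  apply/eq_in_count => y yX /=.
  apply/mapP/eqP => [[z zX]|->].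
    (* The weights are positive with sum 2M, so a weighted sum equal to 2M M of entries at most M
       forces both entries to be M. *)
    have := XM _ yX; have := XM _ zX => zM yM.
    rewrite !int_mulrn NE aE bE => E; nia.
  by exists M => //; rewrite !int_mulrn NE aE bE; ring.
- rewrite /f count_conv_mulrn // -size_filter neq_ltn; apply/orP; right.
  have Mx : x != M by apply/eqP; lia.
  apply: (@uniq_leq_size _ [:: x; M]); first by rewrite /= inE Mx.
  move=> y; rewrite !inE mem_filter => /orP[] /eqP ->.
    rewrite xX andbT; apply/mapP; exists x => //.
    by rewrite !int_mulrn NE aE bE; ring.
  rewrite MX andbT; apply/mapP; exists (- M); first exact: SX.
  by rewrite !int_mulrn NE aE bE; ring.
Qed.

(** Induction on the size. If all absolute values agree, [X] is the pair itself; otherwise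
    [schur_int_split] cuts [X] into two smaller symmetric parts, and the one containing [k] is
    kept. *)
Lemma schur_int_pair_symmetric X k :
  P X -> uniq X -> {in X, forall y, - y \in X} -> k \in X -> P [:: k; - k].
Proof.
have [m] := ubnP (size X); elim: m X => // m IHm X Xm PX UX SX kX.
have [y yX yM] := int_seq_max kX.
have MX : `|y| \in X by have [_|_] := ger0P y; rewrite ?SX.
have [XE|/allPn[x xX xy]] := boolP (all (fun x => `|x| == `|y|) X).
  have kE : `|k| = `|y| by apply/eqP/(allP XE).
  have memX g : (g \in X) = (`|g| == `|k|).
    apply/idP/eqP => [/(allP XE)/eqP ->//|].
    rewrite kE; have [_ ->//|_ E] := ger0P g.
    by rewrite -(opprK g) SX // E.
  (* The list [[:: k; - k]] counts 0 twice when k = 0. *)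
  have countE g : count_mem g [:: k; - k] = ((g \in X) * (k == 0%R).+1)%N.
    by rewrite memX /=; lia.
  by apply: (schur_count schurP PX) => g h; rewrite !countE !(count_uniq_mem _ UX) => ->.
have xM : `|x| < `|y| by rewrite lt_neqAle xy yM.
have [a [Pa aN aM ax]] := schur_int_split PX UX SX MX xX yM xM.
have Pa' : P (filter (predC a) X).
  apply: (schur_filter schurP PX UX); exists (filter a X) => // g h gX hX.
  rewrite !(count_uniq_mem _ (filter_uniq _ UX)) !mem_filter gX hX !andbT /=.
  by move=> /(can_inj oddb) ->.
have Sa (c : pred int) : (forall z, c (- z) = c z) ->
    {in filter c X, forall z, - z \in filter c X}.
  by move=> cN z; rewrite !mem_filter cN => /andP[-> /SX].
have lt_size (c : pred int) z : z \in X -> ~~ c z -> (size (filter c X) < m)%N.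
  move=> zX cz; apply: leq_trans (_ : size X <= m)%N => //.
  rewrite size_filter -(count_predC c X) -addn1 leq_add2l -has_count.
  by apply/hasP; exists z.
have [ak|ak] := boolP (a k).
  apply: (IHm (filter a X)); rewrite ?filter_uniq ?mem_filter ?ak //.
    exact: lt_size ax.
  exact: Sa.
apply: (IHm (filter (predC a) X)); rewrite ?filter_uniq ?mem_filter /= ?ak //.
  by apply: lt_size MX _; rewrite /= aM.
by apply: Sa => z /=; rewrite aN.
Qed.

(* The classes of a Schur ring over the infinite cyclic group are contained in
   sets {k, -k}. *)
Lemma schur_int_pair X k : P X -> k \in X -> P [:: k; - k].
Proof.
move=> PX kX; apply: (@schur_int_pair_symmetric (undup (X ++ map -%R X))).
- apply: (schur_measurable schurP PX (schur_opp schurP PX)) => g h.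
  rewrite !(count_uniq_mem _ (undup_uniq _)) !mem_undup !mem_cat.
  by rewrite -!has_pred1 !has_count => -> ->.
- exact: undup_uniq.
- move=> y; rewrite !mem_undup !mem_cat => /orP[yX|/mapP[z zX ->]].
    by rewrite map_f // orbT.
  by rewrite opprK zX.
- by rewrite mem_undup mem_cat kX.
Qed.

End Integers.

(** * Schur rings over Z x Z_n *)

Section SchurRing.
Variables (F : fieldType) (n : nat).
(** The cyclic factor has order [n.+1], so that the ordinals form a [zmodType]. The group is thus
    written additively, and [g *+ m] is the m-th power. *)
Local Notation G := (int * 'I_n.+1)%type.
Variable D : {fset Gt n.+1} -> Prop.
Hypothesis pcharF : [pchar F] =i pred0.
Hypothesis schurD : is_schur_partition F D.
Implicit Types (s t u : seq G) (g h : G) (C : {fset Gt n.+1}).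

Lemma gmulE g h : gmul g h = g + h.
Proof. by congr (_, _); apply: val_inj. Qed.

Lemma ginvE g : ginv g = - g.
Proof. by congr (_, _); apply: val_inj. Qed.

Lemma is_oneE g : is_one g = (g == 0).
Proof. by []. Qed.

(** Membership in the Schur ring of an element with natural coefficients, put as constancy on
    classes to avoid exhibiting linear combinations. *)
Definition class_constant s : Prop :=
  forall C, D C -> forall g h, g \in C -> h \in C -> count_mem g s = count_mem h s.

Lemma class_constant_cat s t u : class_constant s -> class_constant t ->
  (forall g, count_mem g u = (count_mem g s + count_mem g t)%N) -> class_constant u.
Proof. by move=> Ps Pt uE C DC g h gC hC; rewrite !uE (Ps C DC g h) ?(Pt C DC g h). Qed.

Lemma class_of g : exists2 C, D C & g \in C.
Proof. by have [_ [cov _ _ _ _]] := schurD; have [C []] := cov g; exists C. Qed.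

Lemma class_constant_class C : D C -> class_constant C.
Proof.
move=> DC C' DC' g h gC' hC'.
have [_ [_ disj _ _ _]] := schurD.
rewrite !count_uniq_mem ?fset_uniq //; congr nat_of_bool.
by apply/idP/idP => ?; [rewrite -(disj C' C g) | rewrite -(disj C' C h)].
Qed.

(** Characteristic 0 enters here: equal coefficients in [F] come from equal multiplicities. *)
Lemma natF_inj : injective (fun m : nat => m%:R : F).
Proof.
have /pcharf0P natF0 := pcharF.
move=> i j; wlog ij : i j / (i <= j)%N.
  by move=> W E; have [/W->|/ltnW/W->] := leqP i j.
move=> /eqP; rewrite eq_sym -subr_eq0 -natrB //.
by rewrite natF0 subn_eq0 => ji; apply/eqP; rewrite eqn_leq ij.
Qed.

(** The coefficients in [F] given by the product axiom are images of multiplicities, and in a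
    combination of class sums the same terms contribute at any two elements of one class. *)
Lemma class_constant_conv_classes C C' : D C -> D C' ->
  class_constant (conv (C : seq G) (C' : seq G)).
Proof.
move=> DC DC' E DE g h gE hE; have [_ [_ disj _ _ pr]] := schurD.
have coefE x : prod_coef F C C' x = (count_mem x (conv (C : seq G) (C' : seq G)))%:R.
  rewrite count_conv natr_sum; apply: eq_bigr => c _.
  rewrite -sum1_count natr_sum [RHS]big_mkcond /=; apply: eq_bigr => d _.
  by rewrite gmulE addrC [in RHS]eq_sym subr_eq [in RHS]eq_sym; case: eqP.
apply: natF_inj; rewrite -!coefE.
have [l [Dl lE]] := pr _ _ DC DC'.
rewrite !lE /lin_coef big_seq_cond [RHS]big_seq_cond; apply: eq_bigl => q.
have [/Dl Dq|//] := boolP (q \in l).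
by apply/idP/idP => ?; [rewrite -(disj E q.2 g) | rewrite -(disj E q.2 h)].
Qed.

(** Reduces products to products of two classes. Together with its first entry, [s] contains the
    whole class of that entry, which is split off. *)
Lemma class_constant_decompose s : class_constant s ->
  exists2 l : seq {fset Gt n.+1}, {in l, forall C, D C} &
    forall g, count_mem g s = count_mem g (flatten [seq (C : seq G) | C <- l]).
Proof.
have [m] := ubnP (size s); elim: m s => // m IHm [|x s] sm Ps.
  by exists [::].
have [C DC xC] := class_of x.
have CE g : count_mem g (C : seq G) = (g \in C) by rewrite count_uniq_mem ?fset_uniq.
have /count_subseqP[C' sC'] :
    forall g, (count_mem g (C : seq G) <= count_mem g (x :: s))%N.
  move=> g; rewrite CE; have [gC|//] := boolP (g \in C).
  by rewrite (Ps C DC g x gC xC) /= eqxx.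
rewrite perm_sym => /seq.permP eC'; have [u /seq.permP su] := perm_to_subseq sC'.
have suE g : count_mem g (x :: s) = ((g \in C) + count_mem g u)%N.
  by rewrite su count_cat -CE eC'.
have sz : (size u < size (x :: s))%N.
  rewrite -!(count_predT _) su count_cat -[X in (X < _)%N]add0n ltn_add2r.
  by rewrite eC' -has_count; apply/hasP; exists x.
have [|E DE g h gE hE|l Dl lE] := IHm u.
- exact: leq_trans sz _.
- have := Ps E DE g h gE hE; rewrite !suE -!CE.
  by rewrite (class_constant_class DC DE gE hE) => /addnI.
- exists (C :: l); first by move=> E; rewrite inE => /predU1P[->|/Dl].
  by move=> g; rewrite suE lE /= count_cat CE.
Qed.

Lemma class_constant_conv s t : class_constant s -> class_constant t ->
  class_constant (conv s t).
Proof.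
move=> /class_constant_decompose[l Dl sE] /class_constant_decompose[l' Dl' tE].
set s' := flatten _ in sE; set t' := flatten _ in tE.
suff P' : class_constant (conv s' t').
  have /seq.permP stE : perm_eq (conv s t) (conv s' t').
    by apply: perm_allpairs; apply/allP => x _; apply/eqP.
  by move=> C DC g h gC hC; rewrite !stE (P' C DC g h).
rewrite /s' /t' {s t s' t' sE tE}; elim: l Dl => // C l IHl Dl.
apply: (class_constant_cat (s := conv (C : seq G) (flatten [seq (C : seq G) | C <- l']))).
- have DC : D C by apply: Dl; rewrite mem_head.
  elim: l' Dl' {IHl} => [|C' l' IHl'] Dl'.
    by rewrite /= /conv allpairs0r.
  apply: (class_constant_cat (s := conv (C : seq G) (C' : seq G))).
  + by apply: class_constant_conv_classes => //; apply: Dl'; rewrite mem_head.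
  + by apply: IHl' => E El; apply: Dl'; rewrite inE El orbT.
  + move=> g; rewrite /= !count_conv -big_split.
    by apply: eq_bigr => x _; rewrite count_cat.
- by apply: IHl => E El; apply: Dl; rewrite inE El orbT.
- by move=> g; rewrite /= /conv allpairs_cat count_cat.
Qed.

Lemma class_constant_schur : schur_family (class_constant : seq G -> Prop).
Proof.
split=> [s t u Ps Pt uE C DC g h gC hC||s Ps C DC g h gC hC].
- by apply: uE; [apply: (Ps C) | apply: (Pt C)].
- exact: class_constant_conv.
have [_ [_ _ _ opp _]] := schurD.
have opC x : x \in C -> - x \in [fset ginv y | y in C]%fset.
  by move=> xC; apply/imfsetP; exists x => //=; rewrite ginvE.
by rewrite !count_opp; apply: (Ps _ (opp _ DC)); apply: opC.
Qed.

(** * The projection to Z and the induced Schur ring *)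

Definition pull (X : seq int) : seq G := [seq (k, a) | k <- X, a <- enum 'I_n.+1].

Lemma count_pull X g : count_mem g (pull X) = count_mem g.1 X.
Proof.
case: g => k a; elim: X => //= x X IHX.
rewrite /pull allpairs_cons count_cat IHX count_map; congr (_ + _)%N.
have [->|xk] := eqVneq x k; last first.
  rewrite (eq_count (a2 := pred0)) ?count_pred0 // => b /=.
  by rewrite xpair_eqE (negPf xk).
transitivity (count_mem a (enum 'I_n.+1)); last first.
  by rewrite count_uniq_mem ?enum_uniq // mem_enum.
apply: eq_count => b /=.
by rewrite xpair_eqE eqxx.
Qed.

Lemma Gt_eq g h : g.1 = h.1 -> g.2 = h.2 -> g = h.
Proof. by case: g h => [? ?] [? ?] /= -> ->. Qed.

Lemma mulrn_snd (m : nat) g : m = 1 %[mod n.+1] -> (g *+ m).2 = g.2.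
Proof.
move=> m1; have -> : (g *+ m).2 = g.2 *+ m.
  by elim: {m1} m => // j IHj; rewrite !mulrS /= IHj.
by apply: val_inj; rewrite Zp_mulrn /= -modnMmr m1 modnMmr muln1 modn_small.
Qed.

Lemma mulrn_fst (m : nat) g : (g *+ m).1 = g.1 *+ m.
Proof. by elim: m => // j IHj; rewrite !mulrS /= IHj. Qed.

Lemma mulrn_inj m : (0 < m)%N -> m = 1 %[mod n.+1] -> injective (fun g : G => g *+ m).
Proof.
move=> m0 m1 g h /= gh; have := congr1 fst gh; have := congr1 snd gh.
rewrite !mulrn_snd // !mulrn_fst => gh2 /int_mulrn_inj gh1.
by apply: Gt_eq; first exact: gh1.
Qed.

Let schurP := class_constant_schur.

Lemma mem_class C s g h : D C -> class_constant s -> g \in C -> h \in C ->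
  (g \in s) = (h \in s).
Proof. by move=> DC Ps gC hC; rewrite -!has_pred1 !has_count (Ps C DC g h). Qed.

(** Take [m] > |h.1| congruent to 1 modulo the order of the cyclic factor. The S-set C^(m) contains
    the torsion element [g], which the power map fixes, hence also [h]; so [m] divides [h.1], which
    must be 0. *)
Lemma class_torsion C g h : D C -> g \in C -> h \in C -> g.1 = 0 -> h.1 = 0.
Proof.
move=> DC gC hC g0; pose m := (`|h.1| * n.+1 + 1)%N.
have m0 : (0 < m)%N by rewrite /m addn1.
have m1 : m = 1 %[mod n.+1] by rewrite /m modnMDl.
have := schur_power schurP m0 (mulrn_inj m0 m1) (class_constant_class DC) (fset_uniq C).
set s := map _ _ => Ps.
have : g \in s.
  by apply/mapP; exists g => //; apply: Gt_eq; rewrite ?mulrn_snd // mulrn_fst g0 mul0rn.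
rewrite (mem_class DC Ps gC hC) => /mapP[x _ hE].
have := congr1 fst hE; rewrite mulrn_fst int_mulrn /m /=.
have [->|x0] := eqVneq x.1 0; first by rewrite mul0r.
move: (h.1) (x.1) x0 => k y y0 kE.
have /(congr1 absz) := kE; rewrite abszM absz_nat; nia.
Qed.

Lemma class_constant_pull0 : class_constant (pull [:: 0]).
Proof.
move=> C DC g h gC hC; rewrite !count_pull /= !(eq_sym 0).
by congr (nat_of_bool _ + _)%N; apply/eqP/eqP; apply: class_torsion DC _ _.
Qed.

(** The Schur ring induced over G/Z_n, with [pull X] standing for X Z_n. A product of pullbacks is
    the pullback of the product times the order of Z_n, a factor that cancels when coefficients are
    compared. *)
Lemma pull_schur : schur_family (fun X => class_constant (pull X)).
Proof.
split=> [X Y Z PX PY ZE|X Y PX PY|X PX].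
- apply: (schur_measurable schurP PX PY) => g h; rewrite !count_pull; exact: ZE.
- apply: (schur_count schurP (schur_conv schurP PX PY)) => g h.
  have E x : count_mem x (conv (pull X) (pull Y)) = (n.+1 * count_mem x.1 (conv X Y))%N.
    rewrite !count_conv big_distrr /= big_allpairs; apply: eq_bigr => k _.
    under eq_bigr do rewrite count_pull /=.
    by rewrite big_enum sum_nat_const card_ord.
  by rewrite !E !count_pull => /eqP; rewrite eqn_pmul2l // => /eqP.
- apply: (schur_count schurP (schur_opp schurP PX)) => g h.
  by rewrite !count_opp !count_pull !count_opp.
Qed.

(** Multiplying the class of (k, 0) by Z_n gives the pullback of its projection to the integers.
    That projection contains k, so [schur_int_pair] applies. *)
Lemma class_constant_pull_pair k : class_constant (pull [:: k; - k]).
Proof.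
have [C DC kC] := class_of ((k, 0) : G).
apply: (schur_int_pair pull_schur (X := [seq g.1 | g <- (C : seq G)])); last first.
  by apply/mapP; exists (k, 0).
have PC := schur_conv schurP (class_constant_class DC) class_constant_pull0.
apply: (schur_count schurP PC) => g h; rewrite !count_pull.
have E (x : G) : count_mem x (conv (C : seq G) (pull [:: 0])) =
    count_mem x.1 [seq g.1 | g <- (C : seq G)].
  rewrite count_conv count_map -sum1_count [RHS]big_mkcond; apply: eq_bigr => y _.
  by rewrite count_pull /= addn0 eq_sym subr_eq0 eq_sym; case: eqP.
by rewrite !E.
Qed.

Lemma class_fst C g h : D C -> g \in C -> h \in C -> g.1 = h.1 \/ g.1 = - h.1.
Proof.
move=> DC gC hC; have := class_constant_pull_pair h.1 DC gC hC.
by rewrite !count_pull /= eqxx; do ![case: eqP => [<-|_]; [by auto|]].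
Qed.

(** * Stabilisers of classes *)

Definition stab C g : bool := all (fun x : G => x + g \in C) C.

Lemma succ_mod : n.+2 = 1 %[mod n.+1].
Proof. by rewrite -addn1 modnDl. Qed.

Lemma stabP C g : reflect (forall x : G, x \in C -> x + g \in C) (stab C g).
Proof. exact: allP. Qed.

Lemma stabD C g h : stab C g -> stab C h -> stab C (g + h).
Proof. by move=> /stabP Cg /stabP Ch; apply/stabP => x xC; rewrite addrA Ch ?Cg. Qed.

Lemma stab0 C : stab C 0.
Proof. by apply/stabP => x; rewrite addr0. Qed.

(** The first coordinates of x, x + g and x + 2g all lie in {k, -k}, which holds no three distinct
    terms in progression. *)
Lemma stab_fst C g : D C -> stab C g -> g.1 = 0.
Proof.
move=> DC /stabP Cg; have [C0 _] := schurD; have /fset0Pn[x xC] := C0 C DC.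
have := class_fst DC (Cg _ xC) xC.
have := class_fst DC (Cg _ (Cg _ xC)) xC.
rewrite /=; move: (x.1) (g.1) => k d; lia.
Qed.

Lemma torsion_mulrn g : g.1 = 0 -> g *+ n.+1 = 0.
Proof.
move=> g0; apply: (addrI g); rewrite -mulrS addr0.
by apply: Gt_eq; rewrite ?mulrn_snd ?succ_mod // mulrn_fst g0 mul0rn.
Qed.

Lemma stabN C g : D C -> stab C g -> stab C (- g).
Proof.
move=> DC Cg; have := torsion_mulrn (stab_fst DC Cg).
rewrite mulrS => /eqP; rewrite addrC addr_eq0 => /eqP <-.
suff stabM j : stab C (g *+ j) by [].
by elim: j => [|j IHj]; rewrite ?stab0 // mulrS stabD.
Qed.

(** The coefficient of C^* C at [g] is |C| exactly when [g] stabilises [C], so the stabiliser is a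
    level set of an element of the Schur ring. *)
Lemma stab_subgroup C : D C -> is_S_subgroup D (stab C).
Proof.
move=> DC; split; first split=> [g|g h|g].
- by rewrite is_oneE => /eqP ->; apply: stab0.
- by rewrite gmulE; apply: stabD.
- by rewrite ginvE; apply: stabN.
have PC := class_constant_class DC.
have stabE g : stab C g = (count_mem g (conv (map -%R (C : seq G)) C) == size C).
  rewrite /stab all_count count_conv big_map -sum1_count big_mkcond /=.
  congr (_ == _); apply: eq_bigr => x _.
  by rewrite opprK addrC count_uniq_mem ?fset_uniq //; case: ifP.
move=> E DE.
case: (boolP (has (stab C) E)) => [/hasP[g gE Cg]|/hasPn Cn]; [left=> h hE|right=> h hE].
  have P := schur_conv schurP (schur_opp schurP PC) PC.
  by move: Cg; rewrite !stabE (P E DE g h).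
by apply/negP/Cn.
Qed.

Lemma class_constant0 : class_constant [:: 0 : G].
Proof.
have [_ [_ _ [C [DC CE]] _ _]] := schurD.
apply: (schur_count schurP (class_constant_class DC)) => g h.
rewrite !(count_uniq_mem _ (fset_uniq _)) /= !(eq_sym 0) -!is_oneE -!CE addn0 => ->.
by rewrite addn0.
Qed.

(** * Isolating z^(nk) and z^(-nk) *)

Definition shift_product (m : nat) C : seq G :=
  let M := [seq x *+ m | x <- (C : seq G)] in
  conv M (map -%R (C : seq G)) ++ conv (C : seq G) (map -%R M).

Lemma class_constant_shift_product (m : nat) C :
  (0 < m)%N -> m = 1 %[mod n.+1] -> D C ->
  class_constant (shift_product m C).
Proof.
move=> m0 m1 DC; have PC := class_constant_class DC.
have PM := schur_power schurP m0 (mulrn_inj m0 m1) PC (fset_uniq C).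
apply: (class_constant_cat _ _ (fun g => count_cat _ _ _)).
  by apply: (schur_conv schurP) => //; apply: (schur_opp schurP).
by apply: (schur_conv schurP) => //; apply: (schur_opp schurP).
Qed.

(** An x in [C] over z^k reaches this element only through the first summand, one over z^-k only
    through the second, in both cases exactly when x - (0, b) is in [C]. As k is not 0, every x is
    tested once. *)
Lemma count_shift_product (m : nat) C (k : int) (b : 'I_n.+1) :
  m = n.+2 -> k != 0 ->
  {in (C : seq G), forall x, x.1 = k \/ x.1 = - k} ->
  count_mem ((k * n.+1%:Z, b) : G) (shift_product m C) =
  count (fun x : G => x - (0, b) \in C) C.
Proof.
move=> mE k0 Ck; have m1 : m = 1 %[mod n.+1] by rewrite mE succ_mod.
rewrite count_cat !count_conv big_map -big_split -sum1_count.
rewrite [RHS]big_mkcond; apply: eq_big_seq => x xC /=.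
rewrite !count_opp opprB !count_uniq_mem ?fset_uniq //; last first.
  by rewrite map_inj_uniq ?fset_uniq //; apply: mulrn_inj m1; rewrite mE.
have E1 : (x *+ m - (k * n.+1%:Z, b) \in C) = (x.1 == k) && (x - (0, b) \in C).
  have shiftE : x.1 = k -> x *+ m - (k * n.+1%:Z, b) = x - (0, b).
    move=> xk; apply: Gt_eq; rewrite /= ?(mulrn_snd _ m1) // mulrn_fst int_mulrn xk; lia.
  have [xk|xk] := eqVneq x.1 k; first by rewrite shiftE.
  apply/negP => /Ck /=; rewrite mulrn_fst int_mulrn; move: xk.
  case: (Ck x xC) => [->|->] xk; nia.
have E2 : (x - (k * n.+1%:Z, b) \in [seq y *+ m | y <- (C : seq G)]) =
    (x.1 == - k) && (x - (0, b) \in C).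
  apply/mapP/andP => [[y yC yE]|[/eqP xk xC']].
    have /= := congr1 fst yE; have /= := congr1 snd yE.
    rewrite (mulrn_snd _ m1) mulrn_fst int_mulrn => y2 y1.
    have xk : x.1 = - k by case: (Ck x xC) (Ck y yC) y1 => [->|->] [->|->]; nia.
    split; first by rewrite xk.
    have -> : x - (0, b) = y; last exact: yC.
    apply: Gt_eq; rewrite /= ?subr0 //.
    by move: y1; rewrite xk; case: (Ck y yC) => [->|->]; nia.
  exists (x - (0, b)) => //; apply: Gt_eq; rewrite ?(mulrn_snd _ m1) // mulrn_fst.
  by rewrite /= subr0 int_mulrn xk; nia.
rewrite -[X in (X + _)%N]/(nat_of_bool (_ \in C)) E1 opprB E2.
have kN : k == - k = false by lia.
case: (Ck x xC) => ->; rewrite ?eqxx ?kN 1?eq_sym ?kN /=; by case: ifP.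
Qed.

(** The j-th power of z^e + z^-e is supported in <z^e> and contains z^(ej) and z^(-ej). A class
    meeting <z^e> therefore lies in the support of one of these powers. *)
Lemma cyclic_S_subgroup (e : int) :
  class_constant [:: ((e, 0) : G); (- e, 0)] ->
  is_S_subgroup D (fun g : G => val g.2 = 0%N /\ (e %| g.1)%Z).
Proof.
pose X g := (g.2 == 0) && (e %| g.1)%Z.
have XP g : reflect (val g.2 = 0%N /\ (e %| g.1)%Z) (X g).
  by apply: (iffP andP) => -[] => [/eqP -> | g2 eg]; split=> //; apply/eqP/val_inj.
have XD g h : X g -> X h -> X (g + h).
  by move=> /andP[/eqP g2 eg] /andP[/eqP h2 eh]; rewrite /X /= g2 h2 addr0 eqxx rpredD.
move=> Pe; split; first split=> [g|g h|g].
- by rewrite is_oneE => /eqP ->; split=> //; apply: dvdz0.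
- by move=> /XP Xg /XP Xh; apply/XP; rewrite gmulE; apply: XD.
- move=> /XP/andP[/eqP g2 eg]; apply/XP; rewrite ginvE /X /= g2 oppr0 eqxx.
  by rewrite rpredN.
pose U j := iter j (conv [:: ((e, 0) : G); (- e, 0)]) [:: 0].
have PU j : class_constant (U j).
  by elim: j => [|j IHj]; [apply: class_constant0 | apply: (schur_conv schurP)].
have UX j : {in U j, forall g, X g}.
  elim: j => [|j IHj] g; first by rewrite inE => /eqP ->; rewrite /X /= dvdz0.
  move=> /allpairsP[[x y] /= [xe yU ->]]; apply: XD; last exact: IHj.
  by move: xe; rewrite !inE => /orP[] /eqP ->; rewrite /X /= ?rpredN dvdzz.
have inU j : ((e * j%:Z, 0) : G) \in U j /\ ((- (e * j%:Z), 0) : G) \in U j.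
  elim: j => [|j [IHp IHn]]; first by rewrite mulr0 oppr0 mem_head.
  split; apply/allpairsP;
    [exists ((e, 0), (e * j%:Z, 0)) | exists ((- e, 0), (- (e * j%:Z), 0))];
    rewrite ?inE ?eqxx ?orbT; split=> //; apply: Gt_eq; rewrite /= ?addr0 //; lia.
move=> C DC; case: (boolP (has X C)) => [/hasP[g gC Xg]|/hasPn CX].
  left=> h hC; apply/XP; case/andP: Xg => /eqP g2 /dvdzP[q gq].
  apply: (UX `|q|%N); rewrite -(mem_class DC (PU _) gC hC).
  have [Up Un] := inU `|q|%N.
  have [q0|q0] := leP 0 q.
    by rewrite (_ : g = (e * `|q|%N%:Z, 0)) //; apply: Gt_eq; rewrite ?g2 //= gq; lia.
  by rewrite (_ : g = (- (e * `|q|%N%:Z), 0)) //; apply: Gt_eq; rewrite ?g2 //= gq; nia.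
by right=> h hC /XP; apply/negP/CX.
Qed.

(* The cyclic factor has order n + 1 here, so the power map used is x |-> x^(n+2). *)
Lemma class_constant_pair C g : D C -> g \in C -> g.1 != 0 ->
  (forall b : 'I_n.+1, stab C (0, b) -> b = 0) ->
  class_constant [:: ((g.1 * n.+1%:Z, 0) : G); (- (g.1 * n.+1%:Z), 0)].
Proof.
move=> DC gC k0 C0; set k := g.1 in k0 *; set e := k * _.
have Ck : {in (C : seq G), forall x, x.1 = k \/ x.1 = - k}.
  by move=> x xC; exact: (class_fst DC xC gC).
pose m := n.+2; have mE : m = n.+2 by [].
have PS : class_constant (shift_product m C).
  by apply: class_constant_shift_product => //; rewrite mE succ_mod.
(* Above e and -e, multiplicity |C| singles out b = 0, since it makes -b stabilise [C]. *)
have countS (k' : int) b : k' = k \/ k' = - k ->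
    (count_mem ((k' * n.+1%:Z, b) : G) (shift_product m C) == size C) = (b == 0).
  move=> k'E; rewrite count_shift_product //; first last.
  - by move=> x /Ck; case: k'E => ->; rewrite ?opprK; tauto.
  - by case: k'E => ->; rewrite ?oppr_eq0.
  rewrite -all_count; apply/idP/eqP => [Cb|->]; last first.
    by apply/allP => x xC; rewrite subr0.
  have /C0 /eqP : stab C (0, - b).
    by apply/allP => x /(allP Cb); congr (_ \in C); apply: Gt_eq; rewrite /= ?oppr0.
  by rewrite oppr_eq0 => /eqP.
(* Multiplicity |C| cuts the pair out of the pullback of {e, -e}; both data are coefficients of
   class-constant elements. *)
have countE (x : G) : count_mem x [:: ((e, 0) : G); (- e, 0)] =
    (count_mem x (pull [:: e; - e]) * (count_mem x (shift_product m C) == size C))%N.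
  case: x => x b; rewrite count_pull /= !xpair_eqE !(eq_sym 0 b).
  have [xe|xe] := eqVneq e x.
    by rewrite -xe countS; [case: (b == 0); rewrite ?andbT ?andbF ?muln0 ?muln1 | left].
  have [xe'|xe'] := eqVneq (- e) x; last by [].
  by rewrite -xe' -mulNr countS; [case: (b == 0) | right].
apply: (schur_measurable schurP PS (class_constant_pull_pair e)) => x y Sxy exy.
by rewrite !countE Sxy exy.
Qed.

End SchurRing.

(** * Classes outside K Z_n *)

Local Open Scope nat_scope.
Local Open Scope fset_scope.

Theorem theorem3p2 (F : fieldType) (n : nat) (D : {fset Gt n} -> Prop) (m : nat) :
  [pchar F]%R =i pred0 ->
  0 < n ->
  is_schur_partition F D ->
  (* H = <z^m> is the maximal S-subgroup of G contained in Z *)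
  is_S_subgroup D (multZ m) ->
  (forall X : Gt n -> Prop, is_S_subgroup D X -> (forall g, X g -> inZ g) ->
     forall g, X g -> multZ m g) ->
  (* n | [Z : H]  ([Z : H] = m, or infinite when m = 0) *)
  n %| m ->
  (* K = <z^(m/n)>, so [K : H] = n (K = 1 when H = 1) *)
  forall C, D C -> (forall g, g \in C -> ~ multZ_times_Zn (m %/ n) g) ->
  exists L : Gt n -> Prop,
    [/\ is_S_subgroup D L,
        (forall g, L g -> inZn g),
        (exists g, L g /\ ~~ is_one g) &
        (forall c l, c \in C -> L l -> gmul c l \in C)].
Proof.
case: n D => // n D pcharF _ schurD _ Hmax nm C DC CK.
exists (stab C); split.
- exact: (stab_subgroup pcharF schurD DC).
- by move=> g; apply: (stab_fst pcharF schurD DC).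
(* Were the stabiliser trivial, z^(nk) would lie in H by maximality and z^k in K, against [CK]. *)
- have [/existsP[b /andP[Cb b0]]|/existsPn Cb] :=
      boolP [exists b : 'I_n.+1, stab C (0%R, b) && (b != 0%R)].
    by exists (0%R, b).
  have [C0 _] := schurD; have /fset0Pn[g gC] := C0 C DC.
  case: (CK g gC); rewrite /multZ_times_Zn.
  have [->|k0] := eqVneq g.1 0%R; first exact: dvdz0.
  have C1 b : stab C (0%R, b) -> b = 0%R.
    by move=> Csb; have := Cb b; rewrite Csb negbK => /eqP.
  have Pe := class_constant_pair pcharF schurD DC gC k0 C1.
  have [_] : multZ m (((g.1 * n.+1%:Z)%R, 0%R) : Gt n.+1).
    apply: (Hmax _ (cyclic_S_subgroup pcharF schurD Pe)); first by move=> h [].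
    by split=> //=; apply: dvdzz.
  (* As m = (m/n) n, the factor n cancels from m | kn; for m = 0 this reads k = 0. *)
  by rewrite -{1}(divnK nm) PoszM dvdz_mul2r.
- by move=> c l cC /stabP Cl; rewrite gmulE; apply: Cl.
Qed.
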